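(* Let $\mathbb K$ be $\mathbb R$ or $\mathbb C$ and let $\mathfrak g$ be an $n$-dimensional Lie algebra over $\mathbb K$. Then $\mathfrak g$ admits a regular semisimple algebraic Nijenhuis operator if and only if there exists a basis $\eta_1,\dots,\eta_n$ of $\mathfrak g$ such that for all $i,j$ there are constants $\alpha,\beta\in\mathbb K$ (depending on $i,j$) with $$[\eta_i,\eta_j]=\alpha\,\eta_i+\beta\,\eta_j ,$$ in other words, any two distinct vectors $\eta_i,\eta_j$ of the basis span a two-dimensional Lie subalgebra of $\mathfrak g$.
   Context: Let $\mathfrak g$ be a finite-dimensional Lie algebra over $\mathbb K\in\{\mathbb R,\mathbb C\}$. An algebraic Nijenhuis operator on $\mathfrak g$ is a $\mathbb K$-linear operator $L:\mathfrak g\to\mathfrak g$ such that $$L[L\xi,\eta]+L[\xi,L\eta]-[L\xi,L\eta]-L^2[\xi,\eta]=0\quad\text{for all }\xi,\eta\in\mathfrak g.$$ A linear operator $L:\mathfrak g\to\mathfrak g$ is regular semisimple if it is diagonalizable over $\mathbb K$ (i.e. $\mathfrak g$ has a basis of eigenvectors of $L$) and all its eigenvalues are pairwise different. *)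

(* Defs.v *)
From HB Require Import structures.
From mathcomp Require Export all_boot all_order all_algebra.
From mathcomp Require Export reals complex.

Set Implicit Arguments.
Unset Strict Implicit.
Unset Printing Implicit Defensive.

Import GRing.Theory.
Local Open Scope ring_scope.

HB.mixin Record hasLieBracket (K : fieldType) (V : Type) of Vector K V := {
  lie : V -> V -> V;
  lie_linearl : forall y : V, linear (lie^~ y);
  lie_linearr : forall x : V, linear (lie x);
  lie_alternating : forall x : V, lie x x = 0;
  lie_jacobi : forall x y z : V,
    lie x (lie y z) + lie y (lie z x) + lie z (lie x y) = 0
}.

#[short(type="lieAlgType")]
HB.structure Definition LieAlgebra (K : fieldType) :=
  { V of hasLieBracket K V & Vector K V }.

Section LieAlgebras.
Variables (K : fieldType) (g : lieAlgType K).

Definition nijenhuis (L : 'End(g)) : Prop :=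
  forall x y : g,
    L (lie (L x) y) + L (lie x (L y)) - lie (L x) (L y) - L (L (lie x y)) = 0.

Definition lie_subalgebra (U : {vspace g}) : Prop :=
  forall x y : g, x \in U -> y \in U -> lie x y \in U.

End LieAlgebras.

(* The eigenvalues are listed along an eigenbasis, hence with multiplicity:
   injectivity of lam says that they are pairwise different. *)
Definition regular_semisimple (K : fieldType) (V : vectType K)
    (L : 'End(V)) : Prop :=
  exists (e : (\dim {:V}).-tuple V) (lam : 'I_(\dim {:V}) -> K),
    [/\ basis_of fullv e,
        forall i, L (tnth e i) = lam i *: tnth e i
      & injective lam].

(* Main.v *)
Require Import Defs.
From mathcomp Require Import ring.

Set Implicit Arguments.
Unset Strict Implicit.
Unset Printing Implicit Defensive.

Import GRing.Theory.
Local Open Scope ring_scope.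

(** If L is diagonal in a basis e with eigenvalues lam, then the Nijenhuis
    identity on the pair (e_i, e_j) reads (L - lam_i) (L - lam_j) [e_i, e_j] = 0.
    When the eigenvalues are distinct this kills exactly the components of
    [e_i, e_j] outside the span of e_i and e_j.  Conversely, if [e_i, e_j] lies
    in this span, any operator diagonal in e is Nijenhuis; in characteristic 0
    the eigenvalues 0, 1, 2, ... are distinct. *)

Section LinearAlgebra.
Context {K : fieldType} {V : vectType K}.

Lemma linear_basis_eq0 {W : lmodType K} n (e : n.-tuple V) (f : V -> W) :
  linear f -> basis_of fullv e -> (forall i, f (tnth e i) = 0) ->
  forall x, f x = 0.
Proof.
move=> lin_f basis_e fe0 x; rewrite (coord_basis basis_e (memvf x)).
(* Here [f] is a bare function, so its value at 0 is read off from linearity with scalar -1. *)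
have f0 : f 0 = 0.
  by have := lin_f (-1) 0 0; rewrite scaler0 addr0 scaleN1r addNr.
elim/big_rec: _ => // i v _ fv0.
by rewrite lin_f fv0 -tnth_nth fe0 scaler0 addr0.
Qed.

Lemma coord_tnth n (e : n.-tuple V) (k i : 'I_n) :
  free e -> coord e k (tnth e i) = (i == k)%:R.
Proof. by move=> free_e; rewrite (tnth_nth 0) coord_free. Qed.

Lemma span2P (u v x : V) :
  reflect (exists a b : K, x = a *: u + b *: v) (x \in <<[:: u; v]>>%VS).
Proof.
rewrite span_cons span_seq1.
apply: (iffP memv_addP) => [[y /vlineP[a ->] [z /vlineP[b ->] ->]]|[a [b ->]]].
  by exists a, b.
by exists (a *: u); rewrite ?memvZ ?memv_line //; exists (b *: v);
  rewrite ?memvZ ?memv_line.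
Qed.

(** Up to order, the pair is what remains of [e] after filtering, and a filtered free family stays
    free. *)
Lemma free_tnth2 n (e : n.-tuple V) (i j : 'I_n) :
  free e -> i != j -> free [:: tnth e i; tnth e j].
Proof.
move=> free_e neq_ij; have uniq_e := free_uniq free_e.
have neq_e : tnth e i != tnth e j.
  by apply: contraNneq neq_ij => /(tuple_uniqP _ uniq_e) ->.
have -> : free [:: tnth e i; tnth e j]
        = free [seq x <- e | x \in [:: tnth e i; tnth e j]].
  apply/perm_free/uniq_perm; rewrite ?filter_uniq //= ?inE ?neq_e // => x.
  rewrite mem_filter !inE; case: eqVneq => [->|_]; first by rewrite mem_tnth.
  by case: eqVneq => [->|_]; rewrite ?mem_tnth.
exact: filter_free.
Qed.

Lemma exists_diagonal n (e : n.-tuple V) (lam : 'I_n -> K) :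
  free e -> exists L : 'End(V), forall i, L (tnth e i) = lam i *: tnth e i.
Proof.
move=> free_e.
have [f fE] := linear_of_free e [tuple lam i *: tnth e i | i < n].
exists (linfun f) => i; rewrite lfunE /=.
have := fE free_e; rewrite !size_tuple => /(_ erefl)/(congr1 (nth 0 ^~ i)).
by rewrite (nth_map 0) ?size_tuple // -!tnth_nth tnth_mktuple.
Qed.

End LinearAlgebra.

Section Nijenhuis.
Context {K : fieldType} {g : lieAlgType K}.
Implicit Types (x y z : g) (L : 'End(g)).

Lemma lieDl x y z : lie (x + y) z = lie x z + lie y z.
Proof. by have := lie_linearl z 1 x y; rewrite !scale1r. Qed.

Lemma lieDr x y z : lie x (y + z) = lie x y + lie x z.
Proof. by have := lie_linearr x 1 y z; rewrite !scale1r. Qed.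

Lemma lie0l x : lie 0 x = 0 :> g.
Proof. by apply: (addrI (lie 0 x)); rewrite -lieDl !addr0. Qed.

Lemma lie0r x : lie x 0 = 0 :> g.
Proof. by apply: (addrI (lie x 0)); rewrite -lieDr !addr0. Qed.

Lemma lieZl a x y : lie (a *: x) y = a *: lie x y.
Proof. by have := lie_linearl y a x 0; rewrite lie0l !addr0. Qed.

Lemma lieZr a x y : lie x (a *: y) = a *: lie x y.
Proof. by have := lie_linearr x a y 0; rewrite lie0r !addr0. Qed.

Lemma lieC x y : lie y x = - lie x y.
Proof.
have := lie_alternating (x + y).
rewrite lieDl !lieDr !lie_alternating add0r addr0.
by move/eqP; rewrite addrC addr_eq0 => /eqP.
Qed.

(** The Nijenhuis torsion, named so that its bilinearity can be stated; [nijenhuis L] says that it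
    vanishes identically. *)
Definition torsion L x y : g :=
  L (lie (L x) y) + L (lie x (L y)) - lie (L x) (L y) - L (L (lie x y)).

Lemma torsion_linearl L y : linear (torsion L ^~ y).
Proof.
move=> a x x'; rewrite /torsion !(linearP, lieDl, lieZl) /= !scalerDr !scalerN.
(* Each of the four terms has split in two: odd positions carry [a] and [x], even positions carry
   [x']. *)
by rewrite [LHS](AC (((2*2)*2)*2) ((1*3*5*7)*(2*4*6*8))).
Qed.

Lemma torsion_linearr L x : linear (torsion L x).
Proof.
move=> a y y'; rewrite /torsion !(linearP, lieDr, lieZr) /= !scalerDr !scalerN.
by rewrite [LHS](AC (((2*2)*2)*2) ((1*3*5*7)*(2*4*6*8))).
Qed.

Lemma torsion_basis_nijenhuis L n (e : n.-tuple g) :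
  basis_of fullv e -> (forall i j, torsion L (tnth e i) (tnth e j) = 0) ->
  nijenhuis L.
Proof.
move=> basis_e tors0 x y; rewrite -/(torsion L x y).
apply: (linear_basis_eq0 (torsion_linearr L x) basis_e) => j.
exact: (linear_basis_eq0 (torsion_linearl L (tnth e j)) basis_e).
Qed.

(** The right-hand side is -(L - a)(L - b) applied to [lie x y]. *)
Lemma torsion_eigen L a b x y : L x = a *: x -> L y = b *: y ->
  torsion L x y = (a + b) *: L (lie x y) - (a * b) *: lie x y
                  - L (L (lie x y)).
Proof.
by move=> Lx Ly; rewrite /torsion Lx Ly !(lieZl, lieZr, linearZ) /= scalerA scalerDl.
Qed.

Lemma coord_diagonal L n (e : n.-tuple g) (lam : 'I_n -> K) :
  basis_of fullv e -> (forall i, L (tnth e i) = lam i *: tnth e i) ->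
  forall k x, coord e k (L x) = lam k * coord e k x.
Proof.
move=> basis_e Le k x; apply/eqP; rewrite -subr_eq0; apply/eqP.
(* The type [K^o] views the field as a module over itself, so that [f] can be treated as a linear
   map and tested on [e]. *)
pose f z : K^o := coord e k (L z) - lam k * coord e k z.
have lin_f : linear f.
  by move=> a y z; rewrite /f !linearP /=; rewrite /GRing.scale /=; ring.
apply: (linear_basis_eq0 lin_f basis_e) => i.
rewrite /f Le linearZ /= coord_tnth ?(basis_free basis_e) //.
by case: eqVneq => [->|_]; rewrite ?mulr0 subrr.
Qed.

Lemma nijenhuis_lie_eigen L n (e : n.-tuple g) (lam : 'I_n -> K) :
  basis_of fullv e -> (forall i, L (tnth e i) = lam i *: tnth e i) ->
  injective lam -> nijenhuis L ->
  forall i j, exists a b : K,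
    lie (tnth e i) (tnth e j) = a *: tnth e i + b *: tnth e j.
Proof.
move=> basis_e Le lam_inj nijL i j.
have [<-|neq_ij] := eqVneq i j.
  by exists 0, 0; rewrite lie_alternating !scale0r addr0.
set z := lie _ _; exists (coord e i z), (coord e j z).
have coord0 k : k != i -> k != j -> coord e k z = 0.
  move=> neq_ki neq_kj.
  have := nijL (tnth e i) (tnth e j).
  rewrite -/(torsion L _ _) (torsion_eigen (Le i) (Le j)) -/z.
  move/(congr1 (coord e k)).
  rewrite !linearB !linearZ linear0 /= !(coord_diagonal basis_e Le) => tors0.
  (* The [k]-th coordinate turns L into multiplication by [lam k], so the torsion contributes minus
     this product; both differences are nonzero. *)
  have /eqP : (lam k - lam i) * (lam k - lam j) * coord e k z = 0.
    by rewrite -oppr0 -tors0; rewrite /GRing.scale /=; ring.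
  by rewrite !mulf_eq0 !subr_eq0 !(inj_eq lam_inj) (negPf neq_ki) (negPf neq_kj)
    => /eqP.
(* Only the terms [i] and [j] of the basis expansion of [z] survive. *)
rewrite {1}(coord_basis basis_e (memvf z)) (bigD1 i) //= (bigD1 j) 1?eq_sym //=.
rewrite big1 ?addr0 -?tnth_nth // => k /andP[neq_ki neq_kj].
by rewrite coord0 ?scale0r.
Qed.

Lemma diagonal_nijenhuis L n (e : n.-tuple g) (lam : 'I_n -> K) :
  basis_of fullv e -> (forall i, L (tnth e i) = lam i *: tnth e i) ->
  (forall i j, exists a b : K,
    lie (tnth e i) (tnth e j) = a *: tnth e i + b *: tnth e j) ->
  nijenhuis L.
Proof.
move=> basis_e Le lie_e; apply: (torsion_basis_nijenhuis basis_e) => i j.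
rewrite (torsion_eigen (Le i) (Le j)); have [a [b ->]] := lie_e i j.
have LE c d : L (c *: tnth e i + d *: tnth e j)
            = (c * lam i) *: tnth e i + (d * lam j) *: tnth e j.
  by rewrite linearD !linearZ /= !Le !scalerA.
rewrite !LE; move: (tnth e i) (tnth e j) => u v.
rewrite !scalerDr !scalerA !opprD -!scaleNr.
rewrite [LHS](AC (2*2*2) ((1*3*5)*(2*4*6))) /= -!scalerDl.
(* The coefficient of [u] is a multiple of (p + q)p - pq - p^2 = 0, where p, q are the eigenvalues
   of [u], [v]; that of [v] is symmetric. *)
rewrite [X in X *: u](_ : _ = 0); last by ring.
rewrite [X in X *: v](_ : _ = 0); last by ring.
by rewrite !scale0r addr0.
Qed.

(** Since the bracket is bilinear and alternating, [au + bv, cu + dv] = (ad - bc)[u, v], so closure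
    is decided by [lie u v] alone. *)
Lemma lie_subalgebra_span2 (u v : g) :
  lie_subalgebra <<[:: u; v]>>%VS <->
  exists a b : K, lie u v = a *: u + b *: v.
Proof.
split=> [sub_uv|/span2P uv_in x y /span2P[a [b ->]] /span2P[c [d ->]]].
  by apply/span2P/sub_uv; rewrite memv_span ?inE ?eqxx ?orbT.
rewrite !(lieDl, lieDr, lieZl, lieZr) !lie_alternating (lieC u v).
by rewrite !scaler0 ?(memvD, memvZ, memvN, mem0v).
Qed.

End Nijenhuis.

Lemma natr_inj_real_or_complex (R : realType) (K : fieldType) :
  K = (R : fieldType) \/ K = (R[i] : fieldType) ->
  injective (fun m : nat => m%:R : K).
Proof.
by case=> -> m p /eqP; rewrite Num.Theory.eqr_nat => /eqP.
Qed.

Theorem theorem1 (R : realType) (K : fieldType)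
    (hK : K = (R : fieldType) \/ K = (R[i] : fieldType))
    (n : nat) (g : lieAlgType K) (hn : \dim (fullv : {vspace g}) = n) :
  ((exists L : 'End(g), nijenhuis L /\ regular_semisimple L) <->
   (exists eta : n.-tuple g, basis_of fullv eta /\
      forall i j : 'I_n, exists alpha beta : K,
        lie (tnth eta i) (tnth eta j)
        = alpha *: tnth eta i + beta *: tnth eta j)) /\
  (forall eta : n.-tuple g, basis_of fullv eta ->
     ((forall i j : 'I_n, exists alpha beta : K,
         lie (tnth eta i) (tnth eta j)
         = alpha *: tnth eta i + beta *: tnth eta j) <->
      (forall i j : 'I_n, i != j ->
         \dim <<[:: tnth eta i; tnth eta j]>>%VS = 2%N /\
         lie_subalgebra <<[:: tnth eta i; tnth eta j]>>%VS))).
Proof.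
(* Identifying [n] with the dimension gives [eta] the tuple type used in [regular_semisimple]. *)
subst n; split.
  split=> [[L [nijL [e [lam [basis_e Le lam_inj]]]]]|[e [basis_e lie_e]]].
    by exists e; split=> //; exact: (nijenhuis_lie_eigen basis_e Le lam_inj nijL).
  have [L Le] := exists_diagonal (fun i => (val i)%:R) (basis_free basis_e).
  exists L; split; first exact: (diagonal_nijenhuis basis_e Le lie_e).
  exists e, (fun i => (val i)%:R); split=> // i j.
  by move/(natr_inj_real_or_complex hK)/val_inj.
move=> eta basis_eta; split=> [lie_eta i j neq_ij|sub_eta i j].
  split; last exact/lie_subalgebra_span2.
  (* By definition, a list is free when its span has dimension equal to its length, here 2. *)
  exact/eqP/(free_tnth2 (basis_free basis_eta) neq_ij).
have [<-|/sub_eta[_ /lie_subalgebra_span2//]] := eqVneq i j.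
by exists 0, 0; rewrite lie_alternating !scale0r addr0.
Qed.
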